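(* For any odd prime $p$ and integers $n,d\ge 1$, \[ \delta_{n,p}(d) \le e^{1/3}\exp\left(-\frac{n}{(d^2+d)p^{d^2}}\right). \]
   Context: $\mathbb{F}_p[x]_m$ is the set of monic polynomials in $\mathbb{F}_p[x]$. For $u\in\mathbb{F}_p[x]_m$ and $\alpha\in\mathbb{F}_p[x]/(u)$, $\mathcal{A}_n(u;\alpha) = \{(a_1,\ldots,a_n)\in(\mathbb{F}_p\setminus\{0\})^n : a_1x^{n-1}+\cdots+a_n\equiv\alpha\bmod u\}$, and $\delta_{n,p}(d) = \max_{u\in\mathbb{F}_p[x]_m,\ \deg u=d,\ x\nmid u}\ \max_{\alpha\in\mathbb{F}_p[x]/(u)}\left|\frac{|\mathcal{A}_n(u;\alpha)|}{(p-1)^n} - p^{-d}\right|$. *)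

(* Defs.v *)
From HB Require Import structures.
From mathcomp Require Import all_boot all_order all_algebra.
From mathcomp Require Import reals.

Set Implicit Arguments.
Unset Strict Implicit.
Unset Printing Implicit Defensive.

Import Order.TTheory GRing.Theory Num.Theory.
Local Open Scope ring_scope.

(* a_1 x^(n-1) + ... + a_n; the coefficient a_(i+1) is [a i]. *)
Definition poly_of_coefs (p n : nat) (a : {ffun 'I_n -> 'F_p}) : {poly 'F_p} :=
  \sum_(i < n) a i *: 'X^(n.-1 - i).

(* [{poly %/ u}] is F_p[x]/(u) when u is monic of positive degree; for the
   degree 0 polynomial u = 1 the library quotients by 'X instead. *)
Definition nz_coefs_congr (p n : nat) (u : {poly 'F_p}) (alpha : {poly %/ u}) :
    {set {ffun 'I_n -> 'F_p}} :=
  [set a : {ffun 'I_n -> 'F_p} |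
     [forall i, a i != 0] && (in_qpoly u (poly_of_coefs a) == alpha)].

(* [{poly_d.+1 'F_p}] is the finite type of polynomials of degree at most d, so
   u ranges over the monic polynomials of degree exactly d not divisible by x.
   The terms are nonnegative and, for d >= 1, the range is nonempty (it contains
   'X^d + 1), so the default value 0 does not affect the maximum. *)
Definition max_discrepancy (R : realType) (n p d : nat) : R :=
  \big[Num.max/0]_(u : {poly_d.+1 'F_p} |
      [&& (u : {poly 'F_p}) \is monic, size u == d.+1
        & ~~ ('X %| (u : {poly 'F_p}))])
    \big[Num.max/0]_(alpha : {poly %/ (u : {poly 'F_p})})
      `| #|nz_coefs_congr n alpha|%:R / (p.-1)%:R ^+ n - p%:R ^- d |.

(* Main.v *)
(* Expanding the counting function in additive characters of F_p[x]/(u), i.e.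
   in psi o l for a fixed nontrivial character psi of F_p and the linear
   functionals l, the discrepancy becomes p^(-d) times
   a sum over l <> 0 of unimodular multiples of (-1/(p-1))^m(l), where m(l) is
   the number of i < n with l(x^i) <> 0. As x is a unit modulo u, any d
   consecutive powers of x span the quotient, so m(l) >= floor(n/d). Hence the
   discrepancy is at most (p-1)^(-floor(n/d)) <= 2^(-floor(n/d)), which is far
   below the required bound. *)
Require Import Defs.
From mathcomp Require Import all_boot all_order all_algebra all_field.
From mathcomp Require Import ring lra zify.
From mathcomp Require Import reals sequences exp.
Import Order.TTheory GRing.Theory Num.Theory.
Local Open Scope ring_scope.

(** * Character sums and counting by Fourier expansion *)

Lemma sum_character (V : finZmodType) (R : idomainType) (chi : V -> R) (v : V) :
    {morph chi : x y / x + y >-> x * y} -> chi v != 1 ->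
  \sum_x chi x = 0.
Proof.
(* Translating the summation variable by [v] preserves the sum, yet multiplies it by [chi v]. *)
move=> chiD chiv; have: (chi v - 1) * (\sum_x chi x) == 0.
  rewrite mulrBl mul1r subr_eq0 mulr_sumr [X in _ == X](reindex_inj (addrI v)).
  by apply/eqP/eq_bigr => x _; rewrite chiD.
by rewrite mulf_eq0 subr_eq0 (negPf chiv) => /eqP.
Qed.

Section Fourier.

Context {p : nat} {z : algC}.
Hypotheses (p_prime : prime p) (z_prim : p.-primitive_root z).

(** A nontrivial additive character of [F_p], computed on representatives in [nat]; additivity rests
    on [z ^+ p = 1]. *)
Definition psi (x : 'F_p) : algC := z ^+ x.

Lemma psi0 : psi 0 = 1. Proof. exact: expr0. Qed.

Lemma psiD : {morph psi : x y / x + y >-> x * y}.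
Proof.
move=> x y; rewrite /psi -exprD -(prim_expr_mod z_prim (_ + _)%N).
by congr (z ^+ (_ %% _)%N); exact: Fp_cast.
Qed.

Lemma psi1_neq1 : psi 1 != 1.
Proof.
by rewrite /psi -(prim_order_dvd z_prim) /= modn_small ?gtnNdvd ?prime_gt1
  ?Fp_cast ?prime_gt1.
Qed.

Lemma norm_psi x : `|psi x| = 1.
Proof.
have z1 : `|z| = 1.
  apply/eqP; rewrite -(@pexpr_eq1 _ _ p) ?prime_gt0 ?normr_ge0 //.
  by rewrite -normrX (prim_expr_order z_prim) normr1.
by rewrite normrX z1 expr1n.
Qed.

Lemma psi_sum (I : finType) (F : I -> 'F_p) :
  psi (\sum_i F i) = \prod_i psi (F i).
Proof. exact: (big_morph psi psiD psi0). Qed.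

Lemma sum_psi_mul t : \sum_(x : 'F_p) psi (x * t) = (p * (t == 0))%:R.
Proof.
have [->|t0] := eqVneq t 0.
  rewrite muln1 (eq_bigr (fun=> 1)) => [|x _]; last by rewrite mulr0 psi0.
  by rewrite sumr_const card_Fp.
rewrite muln0; apply: (@sum_character _ _ _ t^-1) => [x y|].
  by rewrite mulrDl psiD.
by rewrite mulVf ?psi1_neq1.
Qed.

Lemma sum_psi_mul_neq0 t :
  \sum_(x : 'F_p | x != 0) psi (x * t) = if t == 0 then p.-1%:R else -1.
Proof.
have := sum_psi_mul t; rewrite (bigD1 0) //= mul0r psi0.
move=> /(canRL (addKr _)) ->.
case: eqP => _; last by rewrite muln0 addr0.
by rewrite muln1 -{1}(prednK (prime_gt0 p_prime)) mulrS addKr.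
Qed.

Lemma sum_psi_mulmx d (w : 'rV['F_p]_d) :
  \sum_(l : 'cV_d) psi ((w *m l) 0 0) = ((p ^ d) * (w == 0))%:R.
Proof.
have [->|] := eqVneq w 0.
  rewrite (eq_bigr (fun=> 1)) => [|l _]; last by rewrite mul0mx mxE psi0.
  by rewrite sumr_const card_mx card_Fp // !muln1.
rewrite muln0 => /rV0Pn[j wj].
apply: (@sum_character _ _ _ ((w 0 j)^-1 *: delta_mx j 0)) => [x y|].
  by rewrite mulmxDr mxE psiD.
by rewrite -scalemxAr -colE !mxE mulVf ?psi1_neq1.
Qed.

(** Orthogonality over all [l] detects the vector equation; once the sums are exchanged, the
    independent choices of the [a i] turn the inner sum into a product over [i]. *)
Lemma card_nz_comb_Fourier n d (v : 'I_n -> 'rV['F_p]_d) (w : 'rV['F_p]_d) :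
  (p ^ d * #|[set a : {ffun 'I_n -> 'F_p} |
      [forall i, a i != 0] & \sum_i a i *: v i == w]|)%:R =
  \sum_(l : 'cV_d) psi (- (w *m l) 0 0) *
     \prod_i (if v i *m l == 0 then p.-1%:R else -1).
Proof.
rewrite -sum1_card natrM natr_sum mulr_sumr.
transitivity (\sum_(a in ffun_on (fun x : 'F_p => x != 0))
   \sum_(l : 'cV_d) psi (((\sum_(i < n) a i *: v i - w) *m l) 0 0)).
  rewrite [RHS](bigID (fun a : {ffun _} => \sum_i a i *: v i == w)) /=.
  rewrite [X in _ + X]big1 ?addr0 => [|a /andP[_ aw]]; last first.
    by rewrite sum_psi_mulmx subr_eq0 (negPf aw) muln0.
  apply: eq_big => [a|a /[1!inE] /andP[_ aw]].
    by rewrite inE; congr (_ && _); apply/forallP/ffun_onP.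
  by rewrite sum_psi_mulmx subr_eq0 aw muln1 mulr1.
rewrite exchange_big; apply: eq_bigr => l _ /=.
pose f i x := psi (x * (v i *m l) 0 0).
transitivity (psi (- (w *m l) 0 0) * \prod_i \sum_(x : 'F_p | x != 0) f i x).
  rewrite bigA_distr_big mulr_sumr; apply: eq_bigr => a _.
  rewrite mulmxBl mxE addrC psiD mulmx_suml summxE psi_sum.
  congr (psi _ * _); first by rewrite mxE.
  by apply: eq_bigr => i _; rewrite -scalemxAl mxE.
congr (_ * _); apply: eq_bigr => i _; rewrite /f sum_psi_mul_neq0.
congr (if _ then _ else _); apply/eqP/eqP => [vl|->]; last by rewrite mxE.
by rewrite [LHS]mx11_scalar vl raddf0.
Qed.

End Fourier.

(** Stated over [algC] because the characters need a primitive [p]-th root of unity. *)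
Lemma nz_comb_discrepancy_algC (p n d k : nat) (v : 'I_n -> 'rV['F_p]_d)
    (w : 'rV['F_p]_d) :
    prime p ->
    (forall l : 'cV_d, l != 0 -> (k <= #|[pred i | (v i *m l != 0)%R]|)%N) ->
  `|#|[set a : {ffun 'I_n -> 'F_p} |
      [forall i, a i != 0] & \sum_i a i *: v i == w]|%:R / p.-1%:R ^+ n
    - p%:R ^- d| <= p.-1%:R ^- k :> algC.
Proof.
move=> p_prime v_k; have [z z_prim] := C_prim_root_exists (prime_gt0 p_prime).
set N := #|_|; set q : algC := p.-1%:R.
have q_ge1 : 1 <= q by rewrite ler1n -ltnS prednK ?prime_gt1 ?prime_gt0.
have q_gt0 : 0 < q by exact: lt_le_trans ltr01 q_ge1.
have pd_gt0 : 0 < p%:R ^+ d :> algC by rewrite exprn_gt0 ?ltr0n ?prime_gt0.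
have qn_gt0 m : 0 < q ^+ m by rewrite exprn_gt0.
pose G (l : 'cV['F_p]_d) : algC := psi (z := z) (- (w *m l) 0 0) *
     \prod_i (if v i *m l == 0 then q else -1).
(* The term [l = 0] is the main term [q ^+ n]; the others form the error. *)
have NE : p%:R ^+ d * N%:R - q ^+ n = \sum_(l | l != 0) G l.
  have := card_nz_comb_Fourier p_prime z_prim n d v w.
  rewrite natrM natrX => ->.
  rewrite (bigD1 0) //= mulmx0 mxE oppr0 psi0 mul1r.
  rewrite (eq_bigr (fun=> q)) => [|i _]; last by rewrite mulmx0 eqxx.
  by rewrite prodr_const card_ord addrAC subrr add0r.
have G_le l : l != 0 -> `|G l| <= q ^+ n / q ^+ k.
  move=> l0; rewrite normrM norm_psi // mul1r normr_prod ler_pdivlMr //.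
  (* Factors with [v i *m l = 0] have norm [q] and number at most [n - k]; all others have norm
     1. *)
  rewrite (bigID (fun i => v i *m l == 0)) /=.
  rewrite (eq_bigr (fun=> q)) => [|i /eqP->]; last first.
    by rewrite eqxx gtr0_norm.
  rewrite [X in _ * X * _]big1 => [|i /negPf->]; last by rewrite normrN1.
  rewrite prodr_const mulr1 -exprD ler_weXn2l //.
  rewrite -[leqRHS](card_ord n) -(cardC [pred i | v i *m l == 0]) leq_add2l.
  exact: v_k.
have -> : N%:R / q ^+ n - p%:R ^- d =
    (\sum_(l | l != 0) G l) / (p%:R ^+ d * q ^+ n).
  by rewrite -NE; field; rewrite ?gt_eqF.
rewrite normrM normfV [`|_ * _|]gtr0_norm ?mulr_gt0 // ler_pdivrMr ?mulr_gt0 //.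
apply: le_trans (ler_norm_sum _ _ _) _.
apply: le_trans (ler_sum _ G_le) _.
rewrite sumr_const -[leLHS]mulr_natr.
have -> : q ^- k * (p%:R ^+ d * q ^+ n) = q ^+ n / q ^+ k * (p ^ d)%:R.
  by rewrite natrX; ring.
apply: ler_wpM2l; first by rewrite divr_ge0 ?ltW.
(* There are at most [p ^ d] error terms, which cancels the factor [p ^ d] in the denominator. *)
rewrite ler_nat.
by apply: leq_trans (max_card _) _; rewrite card_mx muln1 card_Fp.
Qed.

(* The inequality is between rationals, so it descends from algC to rat and
   then passes to R. *)
Lemma nz_comb_discrepancy (R : numFieldType) (p n d k : nat)
    (v : 'I_n -> 'rV['F_p]_d) (w : 'rV['F_p]_d) :
    prime p ->
    (forall l : 'cV_d, l != 0 -> (k <= #|[pred i | (v i *m l != 0)%R]|)%N) ->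
  `|#|[set a : {ffun 'I_n -> 'F_p} |
      [forall i, a i != 0] & \sum_i a i *: v i == w]|%:R / p.-1%:R ^+ n
    - p%:R ^- d| <= p.-1%:R ^- k :> R.
Proof.
move=> p_prime /(@nz_comb_discrepancy_algC p n d k v w p_prime); set N := #|_|.
have ratE (F : numFieldType) :
    (`|N%:R / p.-1%:R ^+ n - p%:R ^- d| <= p.-1%:R ^- k :> F) =
    (`|N%:R / p.-1%:R ^+ n - p%:R ^- d| <= p.-1%:R ^- k :> rat).
  rewrite -(ler_rat F) ratr_norm rmorphB fmorph_div !fmorphV !rmorphXn /=.
  by rewrite !ratr_nat.
by rewrite !ratE.
Qed.

(** * Counting over windows of consecutive exponents *)

Lemma leq_count_windows (P : pred nat) (d n : nat) :
    (forall j, exists2 i, (i < d)%N & P (j + i)%N) ->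
  (n %/ d <= count P (iota 0 n))%N.
Proof.
(* The first [k * d] integers split into [k] disjoint windows of length [d], each containing a hit;
   the incomplete last window of [n] is dropped. *)
move=> P_d; have P_k k : (k <= count P (iota 0 (k * d)))%N.
  elim: k => // k IHk.
  rewrite mulSnr iotaD count_cat -addn1 leq_add // -has_count.
  have [i i_d Pi] := P_d (k * d)%N; apply/hasP; exists (k * d + i)%N => //.
  by rewrite mem_iota leq_addr ltn_add2l.
apply: leq_trans (P_k _) _.
by rewrite -[n in leqRHS](subnKC (leq_divM n d)) iotaD count_cat leq_addr.
Qed.

(** Needed because [poly_of_coefs] pairs [a i] with the exponent [n.-1 - i], whereas windows run
    upwards. *)
Lemma card_ord_rev (P : pred nat) (n : nat) :
  #|[pred i : 'I_n | P (n.-1 - i)%N]| = count P (iota 0 n).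
Proof.
have <- : index_iota 0 n = iota 0 n by rewrite /index_iota subn0.
rewrite -sum1_card -sum1_count big_mkord.
rewrite (reindex_inj rev_ord_inj); apply: eq_bigl => i; rewrite !inE /=.
by congr (P _); have := ltn_ord i; lia.
Qed.

(** * Powers of ['X] in the quotient by [u] *)

Section Quotient.

Context {F : fieldType} (u : {poly F}).
Hypotheses (u_monic : u \is monic) (u_size : (1 < size u)%N).

Lemma mk_monic_id : mk_monic u = u.
Proof. by rewrite /mk_monic u_size u_monic. Qed.

Lemma in_qpoly_val (y : {poly %/ u}) : in_qpoly u y = y.
Proof. by apply/val_inj/in_qpoly_small/size_mk_monic. Qed.

Lemma in_qpoly_modulus : in_qpoly u u = 0.
Proof.
by apply/val_inj; rewrite /= mk_monic_id Pdiv.RingMonic.rmodpp.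
Qed.

Lemma qX_invertible : ~~ ('X %| u) -> exists y, in_qpoly u 'X * y = 1.
Proof.
(* Since 0 is not a root of [u], ['X] is coprime to [u]; its Bezout coefficient [b] gives the
   inverse. *)
rewrite -['X]subr0 dvdp_XsubCl -coprimepX subr0 => /Bezout_eq1_coprimepP[[a b]].
move=> /(congr1 (in_qpoly u)); rewrite in_qpolyD !in_qpolyM in_qpoly1.
by rewrite in_qpoly_modulus mulr0 add0r mulrC; exists (in_qpoly u b).
Qed.

Lemma functional_window (l : 'cV[F]_(size (mk_monic u)).-1) (j : nat) :
    ~~ ('X %| u) -> l != 0 ->
  exists2 i, (i < (size (mk_monic u)).-1)%N &
    npoly_rV (in_qpoly u 'X^(j + i)) *m l != 0.
Proof.
move=> /qX_invertible[b Xb]; set m := (size _).-1 => l_neq0.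
have [/existsP[i Pi]|/existsPn l_eq0] := boolP [exists i : 'I_m,
  npoly_rV (in_qpoly u 'X^(j + i)) *m l != 0]; first by exists i.
have l0 (y : {poly %/ u}) : npoly_rV y *m l = 0.
  (* As ['X] is invertible, [y] is ['X^j] times the class of a polynomial of degree below [m], hence
     a combination of the window's powers, on all of which [l] vanishes. *)
  have -> : y = in_qpoly u ('X^j * polyn (b ^+ j * y)).
    by rewrite in_qpolyM in_qpoly_val rmorphXn mulrA -exprMn Xb expr1n mul1r.
  rewrite -[polyn _](take_poly_id (size_npoly _)) /take_poly poly_def.
  rewrite mulr_sumr linear_sum /npoly_rV /= linear_sum linear_sum mulmx_suml.
  apply: big1 => i _.
  rewrite -scalerAr -exprD in_qpolyZ !linearZ -scalemxAl.
  by rewrite (eqP (negbNE (l_eq0 i))) scaler0.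
case/eqP: l_neq0; apply/row_matrixP => i.
by rewrite row0 rowE -[delta_mx 0 i]rVnpolyK l0.
Qed.

End Quotient.

Lemma discrepancy_le (R : numFieldType) (p n d : nat) (u : {poly 'F_p})
    (alpha : {poly %/ u}) :
    prime p -> (0 < d)%N -> u \is monic -> size u = d.+1 -> ~~ ('X %| u) ->
  `|#|nz_coefs_congr n alpha|%:R / p.-1%:R ^+ n - p%:R ^- d|
    <= p.-1%:R ^- (n %/ d) :> R.
Proof.
move=> p_prime d_gt0 u_monic u_size Xu.
have u_gt1 : (1 < size u)%N by rewrite u_size.
have dE : (size (mk_monic u)).-1 = d by rewrite mk_monic_id // u_size.
pose r i := npoly_rV (in_qpoly u 'X^i).
have := @nz_comb_discrepancy R p n _ (n %/ d) (fun i => r (n.-1 - i)%N)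
  (npoly_rV alpha) p_prime.
(* The vectors have length [(size (mk_monic u)).-1], equal to [d] only through [dE], so the exponent
   is rewritten rather than the type. *)
move=> H; rewrite -[X in p%:R ^- X]dE; apply: le_trans (H _); last first.
  move=> l l_neq0; rewrite (card_ord_rev (fun i => r i *m l != 0)).
  apply: leq_count_windows => j; rewrite -{1}dE.
  exact: functional_window.
rewrite le_eqVlt; apply/orP; left; apply/eqP; congr (`|_%:R / _ - _|).
apply: eq_card => a; rewrite !inE; congr (_ && _).
(* Coordinates are injective and linear, so the congruence becomes the vector equation. *)
rewrite -(inj_eq (can_inj (@npoly_rV_K _ _))); congr (_ == _).
rewrite /poly_of_coefs linear_sum /r /npoly_rV /= !linear_sum.
apply: eq_bigr => i _.
by rewrite !linearZ.
Qed.

(** * Comparison with the exponential bound *)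

Lemma exprVn_div_le_expR (R : realType) (q D n d : nat) :
    (1 < q)%N -> (0 < d)%N -> (6 * d <= D)%N ->
  q%:R ^- (n %/ d) <= expR (1 / 3%:R) * expR (- (n%:R / D%:R)) :> R.
Proof.
move=> q_gt1 d_gt0 D_ge; set k := (n %/ d)%N.
have q_gt0 : 0 < q%:R :> R by rewrite ltr0n; lia.
have D_gt0 : 0 < D%:R :> R by rewrite ltr0n; lia.
(* Each factor satisfies [1 / q <= 1 / 2 = 1 - 1 / 2 <= expR (- 1 / 2)]. *)
apply: (@le_trans _ _ (expR (k%:R * - 2^-1))).
  rewrite expRM_natl -exprVn lerXn2r ?nnegrE ?invr_ge0 ?expR_ge0 ?ler0n //.
  apply: le_trans (expR_ge1Dx _).
  have -> : 1 - 2^-1 = 2^-1 :> R by field.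
  by rewrite lef_pV2 ?posrE // ler_nat.
rewrite -expRD ler_expR.
(* From [n < (k + 1) * d] and [6 * d <= D]; then [- k / 2 <= 1 / 3 - (k + 1) / 6] for all
   [k >= 0]. *)
have nD : n%:R / D%:R <= (k.+1)%:R / 6 :> R.
  rewrite ler_pdivrMr // mulrAC ler_pdivlMr // -!natrM ler_nat.
  have := ltn_ceil n d_gt0; rewrite -/k; nia.
by have := ler0n R k; rewrite -natr1 in nD; lra.
Qed.

Theorem theorem4p2 (R : realType) (p n d : nat)
    (p_prime : prime p) (p_odd : odd p) (n_ge1 : (1 <= n)%N) (d_ge1 : (1 <= d)%N) :
  max_discrepancy R n p d <=
    expR (1 / 3%:R) *
    expR (- (n%:R / ((d%:R ^+ 2 + d%:R) * p%:R ^+ (d ^ 2)%N))).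
Proof.
have p_ge3 : (3 <= p)%N by exact: odd_prime_gt2.
have pd_ge3 : (3 <= p ^ (d ^ 2))%N.
  by apply: leq_trans p_ge3 _; rewrite -[leqLHS]expn1 leq_pexp2l ?expn_gt0; lia.
have bound : p.-1%:R ^- (n %/ d) <= expR (1 / 3%:R) *
    expR (- (n%:R / ((d%:R ^+ 2 + d%:R) * p%:R ^+ (d ^ 2)%N))) :> R.
  have -> : (d%:R ^+ 2 + d%:R) * p%:R ^+ (d ^ 2)%N =
    ((d ^ 2 + d) * p ^ (d ^ 2))%:R :> R by rewrite natrM natrD !natrX.
  apply: exprVn_div_le_expR => //; first lia.
  (* The constant 6 arises from [d <= d ^ 2] and [3 <= p ^ (d ^ 2)]. *)
  apply: (@leq_trans ((d + d) * 3)); first by lia.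
  by rewrite leq_mul // leq_add2r -[leqLHS]expn1 leq_pexp2l.
(* The default value 0 of each maximum must also lie below the bound. *)
apply: bigmax_le => [|u /and3P[u_monic /eqP u_size Xu]].
  by rewrite mulr_ge0 ?expR_ge0.
apply: bigmax_le => [|alpha _]; first by rewrite mulr_ge0 ?expR_ge0.
apply: le_trans bound.
exact: discrepancy_le.
Qed.
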